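(* Assume countable choice. Let $P:\mathbb N\to\mathsf{Prop}$ be a family of $\omega^2$-decidable propositions. Then $\forall n.\,P_n$ is $\omega^2$-decidable.
   Context: We work in homotopy type theory with propositional truncation. Countable choice: for every type family $B:\mathbb N\to\mathcal U$, $(\forall n.\,\|B(n)\|)\to\|\Pi(n:\mathbb N).\,B(n)\|$. $\mathsf{Brw}$ is the type of Brouwer ordinals, defined as a set-truncated quotient inductive-inductive type simultaneously with a proposition-valued relation $\le$: point constructors $\mathsf{zero}$, $\mathsf{succ}$, and $\mathsf{lim}$ of strictly increasing sequences $f:\mathbb N\to\mathsf{Brw}$ ($\forall n.\,\mathsf{succ}(f_n)\le f_{n+1}$); a path constructor identifying limits of mutually simulating sequences; $\le$ is transitive, proposition-valued, with $\mathsf{zero}$ minimal, $\mathsf{succ}$ monotone, $\mathsf{lim}\,f$ the least upper bound of $f$. $\omega=\mathsf{lim}(\lambda n.\,n)$, $\omega^2=\mathsf{lim}(\lambda k.\,\omega\cdot k)$. A proposition $P$ is $\alpha$-decidable if $\exists y:\mathsf{Brw}.\,(P\leftrightarrow \alpha\le y)$. *)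

(* Defs.v *)
Set Implicit Arguments.
Unset Strict Implicit.

(* [Prop] is read as the universe of propositions: [exists] is the truncated
   sum and [inhabited] is the propositional truncation. *)

Definition countable_choice : Prop :=
  forall B : nat -> Type,
    (forall n, inhabited (B n)) -> inhabited (forall n, B n).

Definition increasing (X : Type) (le : X -> X -> Prop) (succ : X -> X)
    (f : nat -> X) : Prop :=
  forall n, le (succ (f n)) (f (S n)).

Definition simulated (X : Type) (le : X -> X -> Prop) (f g : nat -> X) : Prop :=
  forall k, exists n, le (f k) (g n).

(* Rocq has no quotient inductive-inductive types, so Brw is specified by its
   universal property: it is an initial algebra for the signature below, which
   has one field per constructor of the type and of its order ([bisim] is the
   path constructor, [car_set] and [le_prop] are the truncation constructors).
   Reflexivity and antisymmetry of [le] are not constructors; [le_cocone]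
   combines "f k is below lim f" with transitivity. *)
Record brw_algebra : Type := BrwAlgebra {
  car :> Type;
  le : car -> car -> Prop;
  zero : car;
  succ : car -> car;
  lim : forall f : nat -> car, increasing le succ f -> car;
  bisim : forall f g (Hf : increasing le succ f) (Hg : increasing le succ g),
    simulated le f g -> simulated le g f -> lim Hf = lim Hg;
  car_set : forall (x y : car) (p q : x = y), p = q;
  le_zero : forall x, le zero x;
  le_trans : forall x y z, le x y -> le y z -> le x z;
  le_succ : forall x y, le x y -> le (succ x) (succ y);
  le_cocone : forall f (Hf : increasing le succ f) x k,
    le x (f k) -> le x (lim Hf);
  le_limiting : forall f (Hf : increasing le succ f) x,
    (forall k, le (f k) x) -> le (lim Hf) x;
  le_prop : forall x y (p q : le x y), p = q
}.

Arguments le {_} _ _.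
Arguments zero {_}.
Arguments succ {_} _.
Arguments lim {_ f} _.

(* In [hom_lim] the proof [Hf'] always exists, by [hom_le] and [hom_succ], and
   is unique since [increasing] is a proposition. *)
Record brw_hom (A B : brw_algebra) : Type := BrwHom {
  hom :> A -> B;
  hom_le : forall x y, le x y -> le (hom x) (hom y);
  hom_zero : hom zero = zero;
  hom_succ : forall x, hom (succ x) = succ (hom x);
  hom_lim : forall f (Hf : increasing le succ f),
    exists Hf' : increasing le succ (fun n => hom (f n)),
      hom (lim Hf) = lim Hf'
}.

Record brouwer_ordinals : Type := BrouwerOrdinals {
  brw :> brw_algebra;
  brw_rec : forall A : brw_algebra, brw_hom brw A;
  brw_rec_unique : forall (A : brw_algebra) (g h : brw_hom brw A) (x : brw),
    g x = h x
}.

Section Omega.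

Variable B : brw_algebra.

Definition plus_nat (a : B) (n : nat) : B := Nat.iter n succ a.

Lemma plus_nat_refl (a : B) (Ha : le a a) (n : nat) :
  le (plus_nat a n) (plus_nat a n).
Proof. induction n as [|n IH]; [exact Ha | exact (le_succ IH)]. Qed.

Lemma plus_nat_increasing (a : B) (Ha : le a a) :
  increasing le succ (plus_nat a).
Proof. intro n; exact (plus_nat_refl Ha (S n)). Qed.

Lemma lim_refl (f : nat -> B) (Hf : increasing le succ f) :
  (forall n, le (f n) (f n)) -> le (lim Hf) (lim Hf).
Proof. intro H; apply le_limiting; intro k; exact (le_cocone Hf (H k)). Qed.

Definition omega : B := lim (plus_nat_increasing (le_zero zero)).

(* Addition and multiplication are continuous in the second argument, so
   a + omega = lim (fun n => a + n), omega * 0 = 0 and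
   omega * (k + 1) = omega * k + omega.  The multiples are built together with
   a proof of reflexivity, which is what makes (fun n => a + n) increasing. *)
Definition plus_omega (a : B) (Ha : le a a) : B :=
  lim (plus_nat_increasing Ha).

Fixpoint omega_times_refl (k : nat) : {a : B | le a a} :=
  match k with
  | O => exist (fun a : B => le a a) zero (le_zero zero)
  | S k =>
      let Ha := proj2_sig (omega_times_refl k) in
      exist (fun a : B => le a a) (plus_omega Ha)
        (lim_refl (plus_nat_increasing Ha) (plus_nat_refl Ha))
  end.

Definition omega_times (k : nat) : B := proj1_sig (omega_times_refl k).

Lemma omega_times_increasing : increasing le succ omega_times.
Proof.
intro k.
exact (le_cocone (plus_nat_increasing (proj2_sig (omega_times_refl k)))
         (plus_nat_refl (proj2_sig (omega_times_refl k)) 1)).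
Qed.

Definition omega_squared : B := lim omega_times_increasing.

End Omega.

Definition ordinal_decidable (B : brouwer_ordinals) (alpha : B) (P : Prop) :
    Prop :=
  exists y : B, P <-> le alpha y.

(* Main.v *)
From Stdlib Require Import Arith Lia Cantor FunctionalExtensionality PropExtensionality.
Require Import Defs.

(* Excluded middle would make every proposition omega^2-decidable; only function
   and propositional extensionality are used here.  For every
   y, the proposition omega * k <= y is semidecidable: by induction on y, since
   omega * (k + 1) <= lim f  iff  omega * k <= f n for some n, as f is strictly
   increasing.  So an omega^2-decidable proposition is a countable meet of
   semidecidable ones, and such meets are closed under countable meets.
   Conversely, given semidecidable Q 0, Q 1, ..., search for a witness of Q 0,
   then of Q 1, and so on; the state "j candidates for Q i have been rejected"
   is recorded by the ordinal omega * i + j.  The limit of these states reaches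
   omega^2 exactly when every search succeeds. *)

Section Order.

Variable Brw : brouwer_ordinals.

(** * Induction derived from initiality *)

Section Induction.

Variable P : Brw -> Prop.
Hypothesis P_zero : P zero.
Hypothesis P_succ : forall x, P x -> P (succ x).
Hypothesis P_lim : forall f (Hf : increasing le succ f),
  (forall n, P (f n)) -> P (lim Hf).

Definition sub_algebra : brw_algebra.
Proof.
refine (@BrwAlgebra {x : Brw | P x}
  (fun x y => le (proj1_sig x) (proj1_sig y))
  (exist P zero P_zero)
  (fun x => exist P (succ (proj1_sig x)) (P_succ _ (proj2_sig x)))
  (fun f Hf => exist P (lim (f := fun n => proj1_sig (f n)) Hf)
     (P_lim _ Hf (fun n => proj2_sig (f n))))
  _ _ _ _ _ _ _ _); simpl.
- intros f g Hf Hg Hfg Hgf.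
  apply eq_sig_hprop; [intros; apply proof_irrelevance | simpl].
  exact (bisim Hf Hg Hfg Hgf).
- intros; apply proof_irrelevance.
- intro; apply le_zero.
- intros x y z; apply le_trans.
- intros x y; apply le_succ.
- intros f Hf x k H; exact (le_cocone Hf H).
- intros f Hf x H; exact (le_limiting Hf H).
- intros; apply le_prop.
Defined.

Definition sub_endo : brw_hom Brw Brw.
Proof.
pose (h := brw_rec Brw sub_algebra).
refine (@BrwHom Brw Brw (fun x => proj1_sig (h x)) _ _ _ _).
- intros x y; apply (hom_le h).
- now rewrite (hom_zero h).
- intro x; now rewrite (hom_succ h).
- intros f Hf; destruct (hom_lim h Hf) as [Hf' E].
  exists Hf'; now rewrite E.
Defined.

Definition id_endo : brw_hom Brw Brw.
Proof.
refine (@BrwHom Brw Brw (fun x => x) _ _ _ _); auto.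
intros f Hf; now exists Hf.
Defined.

(** Recursion into the subalgebra carved out by [P], followed by projection, is an endomorphism of
    [Brw]. By uniqueness it is the identity, so each [x] carries a proof of [P x]. *)
Lemma brw_ind (x : Brw) : P x.
Proof.
rewrite <- (brw_rec_unique sub_endo id_endo x : proj1_sig _ = x).
apply proj2_sig.
Qed.

End Induction.

(** * Reflexivity and inversion of the order *)

Lemma le_refl (x : Brw) : le x x.
Proof.
revert x; apply brw_ind.
- apply le_zero.
- intros; now apply le_succ.
- intros; now apply lim_refl.
Qed.

Lemma le_lim f (Hf : increasing le succ f) n : le (f n) (lim Hf : Brw).
Proof. apply le_cocone with n; apply le_refl. Qed.

Lemma le_succ_self (x : Brw) : le x (succ x).
Proof.
revert x; apply brw_ind.
- apply le_zero.
- intros; now apply le_succ.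
- intros f Hf IH; apply le_limiting; intro k.
  apply le_trans with (1 := IH k), le_succ, le_lim.
Qed.

(* A pair (y, D) stands for y together with its strict lower set
   D = {x | x < y}; this makes strict lower sets definable by recursion along
   with their monotonicity. *)
Definition lower_set_algebra : brw_algebra.
Proof.
refine (@BrwAlgebra (Brw * (Brw -> Prop))
  (fun p q => le (fst p) (fst q) /\ forall x, snd p x -> snd q x)
  (zero, fun _ => False)
  (fun p => (succ (fst p), fun x => le x (fst p)))
  (fun f Hf => (lim (f := fun n => fst (f n)) (fun n => proj1 (Hf n)),
                fun x => exists n, snd (f n) x))
  _ _ _ _ _ _ _ _); simpl.
- intros f g Hf Hg Hfg Hgf; f_equal.
  + apply bisim; intro k.
    * destruct (Hfg k) as [n [H _]]; now exists n.
    * destruct (Hgf k) as [n [H _]]; now exists n.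
  + apply functional_extensionality; intro x.
    apply propositional_extensionality; split; intros [k Hk].
    * destruct (Hfg k) as [n [_ H]]; exists n; auto.
    * destruct (Hgf k) as [n [_ H]]; exists n; auto.
- intros; apply proof_irrelevance.
- intro; split; [apply le_zero | tauto].
- intros p q r [H1 H2] [H3 H4]; split; [now apply le_trans with (fst q) | auto].
- intros p q [H _]; split; [now apply le_succ |].
  intros x Hx; now apply le_trans with (fst p).
- intros f Hf p k [H1 H2]; split; [now apply le_cocone with k |].
  intros x Hx; exists k; auto.
- intros f Hf p H; split; [apply le_limiting; intro k; apply H |].
  intros x [k Hk]; now apply (H k).
- intros; apply proof_irrelevance.
Defined.

Definition lower_rec : brw_hom Brw lower_set_algebra :=
  brw_rec Brw lower_set_algebra.

Definition lower_set (y : Brw) : Brw -> Prop := snd (lower_rec y).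

Lemma fst_lower_rec (y : Brw) : fst (lower_rec y) = y.
Proof.
revert y; apply brw_ind.
- now rewrite (hom_zero lower_rec).
- intros y IH; rewrite (hom_succ lower_rec); simpl; now rewrite IH.
- intros f Hf IH; destruct (hom_lim lower_rec Hf) as [Hf' E].
  rewrite E; simpl.
  (* The sequences agree pointwise but carry different proofs of [increasing]; [bisim] equates their
     limits without transport. *)
  apply bisim; intro k; exists k; rewrite IH; apply le_refl.
Qed.

Lemma lower_set_zero x : ~ lower_set zero x.
Proof. unfold lower_set; now rewrite (hom_zero lower_rec). Qed.

Lemma lower_set_succ y x : lower_set (succ y) x <-> le x y.
Proof.
unfold lower_set; rewrite (hom_succ lower_rec); simpl.
now rewrite fst_lower_rec.
Qed.

Lemma lower_set_lim f (Hf : increasing le succ f) x :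
  lower_set (lim Hf) x <-> exists n, lower_set (f n) x.
Proof.
unfold lower_set; destruct (hom_lim lower_rec Hf) as [Hf' E].
now rewrite E.
Qed.

(** Source of all inversion principles for [le], since [lower_set] computes on constructors. The
    converse is its monotonicity, applied to [x] in [lower_set (succ x)]. *)
Lemma lower_setE (x y : Brw) : lower_set y x <-> le (succ x) y.
Proof.
split.
- revert y; apply (brw_ind (fun y => lower_set y x -> le (succ x) y)).
  + intro H; now apply lower_set_zero in H.
  + intros y _ H; now apply le_succ, lower_set_succ.
  + intros f Hf IH H; apply lower_set_lim in H; destruct H as [n H].
    apply le_cocone with n; auto.
- intro H; apply (hom_le lower_rec H), lower_set_succ, le_refl.
Qed.

Lemma not_succ_le_zero (x : Brw) : ~ le (succ x) zero.
Proof. rewrite <- lower_setE; apply lower_set_zero. Qed.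

Lemma le_succ_inv (x y : Brw) : le (succ x) (succ y) -> le x y.
Proof. now rewrite <- lower_setE, lower_set_succ. Qed.

Lemma succ_le_lim_inv (x : Brw) f (Hf : increasing le succ f) :
  le (succ x) (lim Hf) -> exists n, le (succ x) (f n).
Proof.
rewrite <- lower_setE, lower_set_lim; intros [n H].
exists n; now apply lower_setE.
Qed.

(** Each [succ (f k)] is below [f (S k)], hence below [succ y]; cancel [succ]. *)
Lemma lim_le_succ_inv f (Hf : increasing le succ f) (y : Brw) :
  le (lim Hf) (succ y) -> le (lim Hf) y.
Proof.
intro H; apply le_limiting; intro k; apply le_succ_inv.
apply le_trans with (1 := Hf k), le_trans with (2 := H), le_lim.
Qed.

Lemma not_succ_le_self (x : Brw) : ~ le (succ x) x.
Proof.
revert x; apply brw_ind.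
- apply not_succ_le_zero.
- intros x IH H; now apply IH, le_succ_inv.
- intros f Hf IH H; apply succ_le_lim_inv in H; destruct H as [n H].
  apply (IH n); apply le_trans with (2 := H), le_succ, le_lim.
Qed.

(** * Comparison with multiples of omega *)

Notation w := (omega_times Brw).

Lemma plus_nat_le_omega_times k j : le (plus_nat (w k) j) (w (S k)).
Proof. apply le_lim with (f := plus_nat (w k)). Qed.

Lemma omega_times_mono i k : i <= k -> le (w i) (w k).
Proof.
induction 1 as [|k _ IH]; [apply le_refl |].
apply le_trans with (1 := IH), (plus_nat_le_omega_times k 0).
Qed.

(** If [i < k], the limit [w (S i)] is below [plus_nat (w i) j]. It sheds the [j] successors one by
    one, ending below [w i], which is absurd. *)
Lemma omega_times_le_plus_nat k i j :
  le (w k) (plus_nat (w i) j) -> k <= i.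
Proof.
intro H; destruct (le_lt_dec k i) as [|L]; [assumption | exfalso].
apply le_trans with (1 := omega_times_mono _ _ L) in H.
induction j as [|j IH].
- apply (not_succ_le_self (w i)).
  apply le_trans with (2 := H), (plus_nat_le_omega_times i 1).
- apply IH; revert H; apply lim_le_succ_inv.
Qed.

Lemma omega_times_le_lim k f (Hf : increasing le succ f) :
  le (w (S k)) (lim Hf) <-> exists n, le (w k) (f n).
Proof.
split.
- intro H; destruct (succ_le_lim_inv (w k) f Hf) as [n Hn].
  + apply le_trans with (2 := H), (plus_nat_le_omega_times k 1).
  + exists n; apply le_trans with (2 := Hn), le_succ_self.
- intros [n Hn]; apply le_limiting; intro m.
  (* Each step of [f] gains at least one successor, so [f (m + n)] is above [plus_nat (w k) m]. *)
  apply le_cocone with (m + n).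
  induction m as [|m IH]; [exact Hn |].
  apply le_trans with (2 := Hf (m + n)); now apply le_succ.
Qed.

Lemma omega_squared_le (y : Brw) :
  le (omega_squared Brw) y <-> forall k, le (w k) y.
Proof.
split.
- intros H k; apply le_trans with (2 := H), le_lim with (f := w).
- intro H; now apply le_limiting.
Qed.

End Order.

(** * Semidecidability *)

Definition semidecidable (P : Prop) : Prop :=
  exists s : nat -> bool, P <-> exists n, s n = true.

Lemma semidecidable_iff (P Q : Prop) :
  (P <-> Q) -> semidecidable Q -> semidecidable P.
Proof. intros H [s Hs]; exists s; now rewrite H. Qed.

Lemma countable_choice_exists (CC : countable_choice) (A : Type)
    (R : nat -> A -> Prop) :
  (forall n, exists a, R n a) -> exists f, forall n, R n (f n).
Proof.
intro H; destruct (CC (fun n => {a | R n a})) as [f].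
- intro n; destruct (H n) as [a Ha]; now constructor; exists a.
- exists (fun n => proj1_sig (f n)); intro n; apply proj2_sig.
Qed.

Lemma semidecidable_exists (CC : countable_choice) (P : nat -> Prop) :
  (forall n, semidecidable (P n)) -> semidecidable (exists n, P n).
Proof.
intro H; apply (countable_choice_exists CC) in H; destruct H as [s Hs].
exists (fun m => let (n, i) := of_nat m in s n i); split.
- intros [n Hn]; apply Hs in Hn; destruct Hn as [i Hi].
  exists (to_nat (n, i)); now rewrite cancel_of_to.
- intros [m Hm]; destruct (of_nat m) as [n i].
  exists n; apply Hs; now exists i.
Qed.

Lemma semidecidable_omega_times (CC : countable_choice)
    (Brw : brouwer_ordinals) (y : Brw) k :
  semidecidable (le (omega_times Brw k) y).
Proof.
revert k.
(* The index [k] stays quantified: at a limit, the case [S k] uses the hypothesis for [k]. *)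
apply (brw_ind Brw (fun y => forall k, semidecidable (le (omega_times Brw k) y)));
  clear y; [| intros y IH | intros f Hf IH];
  (intros [|k]; [exists (fun _ => true); split;
                 [now exists 0 | intro; apply le_zero] |]).
- exists (fun _ => false); split; [| now intros []].
  intro H; exfalso; apply (not_succ_le_zero Brw (omega_times Brw k)).
  apply le_trans with (2 := H), (plus_nat_le_omega_times Brw k 1).
- apply semidecidable_iff with (2 := IH (S k)); split.
  + apply lim_le_succ_inv.
  + intro H; apply le_trans with (1 := H), le_succ_self.
- apply semidecidable_iff with (1 := omega_times_le_lim Brw k f Hf).
  now apply semidecidable_exists.
Qed.

(** * Successive searches and their ordinals *)

Section Search.

Variable s : nat -> nat -> bool.

Fixpoint search (t : nat) : nat * nat :=
  match t with
  | O => (0, 0)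
  | S t =>
      let (i, j) := search t in if s i j then (S i, 0) else (i, S j)
  end.

Lemma search_sound t k : k < fst (search t) -> exists n, s k n = true.
Proof.
induction t as [|t IH]; simpl; [lia |].
destruct (search t) as [i j]; simpl in *.
destruct (s i j) eqn:E; simpl; [| exact IH].
intro H; destruct (Nat.eq_dec k i) as [->|]; [now exists j | apply IH; lia].
Qed.

(** Induction on [n], the distance from the current candidate [j] to a known witness; an earlier
    success ends the search sooner. *)
Lemma search_step t k j n :
  search t = (k, j) -> s k (n + j) = true -> exists t', search t' = (S k, 0).
Proof.
revert t j; induction n as [|n IH]; intros t j Ht Hn;
  destruct (s k j) eqn:E;
  try (exists (S t); simpl; now rewrite Ht, E).
- simpl in Hn; congruence.
- apply (IH (S t) (S j)).
  + simpl; now rewrite Ht, E.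
  + now rewrite <- plus_n_Sm.
Qed.

Lemma search_complete :
  (forall i, exists n, s i n = true) -> forall k, exists t, search t = (k, 0).
Proof.
intros H k; induction k as [|k [t Ht]]; [now exists 0 |].
destruct (H k) as [n Hn]; apply search_step with (n := n) (1 := Ht).
now rewrite <- plus_n_O.
Qed.

Variable Brw : brouwer_ordinals.

Definition search_ordinal (t : nat) : Brw :=
  let (i, j) := search t in plus_nat (omega_times Brw i) j.

(** A rejection adds exactly one successor; a success jumps to the next multiple of omega, above
    every finite addition. *)
Lemma search_ordinal_increasing : increasing le succ search_ordinal.
Proof.
intro t; unfold search_ordinal; simpl; destruct (search t) as [i j].
destruct (s i j).
- apply (plus_nat_le_omega_times Brw i (S j)).
- apply le_refl.
Qed.

Lemma omega_squared_le_search :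
  le (omega_squared Brw) (lim search_ordinal_increasing) <->
  forall i, exists n, s i n = true.
Proof.
rewrite omega_squared_le; split.
(* Passing below the limit costs one [S]; the other gives [S i <= k] for the stage [k] reached, so
   search [i] has succeeded. *)
- intros H i; specialize (H (S (S i))); apply omega_times_le_lim in H.
  destruct H as [t Ht]; apply search_sound with t.
  unfold search_ordinal in Ht; destruct (search t) as [k j].
  exact (omega_times_le_plus_nat _ _ _ _ Ht).
- intros H k; destruct (search_complete H k) as [t Ht].
  apply le_cocone with t; unfold search_ordinal; rewrite Ht; apply le_refl.
Qed.

End Search.

Lemma ordinal_decidable_meet (CC : countable_choice) (Brw : brouwer_ordinals)
    (Q : nat -> Prop) :
  (forall i, semidecidable (Q i)) ->
  ordinal_decidable (omega_squared Brw) (forall i, Q i).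
Proof.
intro H; apply (countable_choice_exists CC) in H; destruct H as [s Hs].
exists (lim (search_ordinal_increasing s Brw)).
rewrite omega_squared_le_search.
split; intros H i; now apply Hs.
Qed.

Theorem theorem8p6 (Brw : brouwer_ordinals) (CC : countable_choice)
    (P : nat -> Prop)
    (HP : forall n, ordinal_decidable (omega_squared Brw) (P n)) :
  ordinal_decidable (omega_squared Brw) (forall n, P n).
Proof.
apply (countable_choice_exists CC) in HP; destruct HP as [y Hy].
(* Each [P n] is itself a meet over [k]; Cantor pairing merges the double family into one
   sequence. *)
destruct (ordinal_decidable_meet CC Brw
  (fun m => let (n, k) := of_nat m in le (omega_times Brw k) (y n)))
  as [z Hz].
- intro m; destruct (of_nat m) as [n k]; now apply semidecidable_omega_times.
- exists z; rewrite <- Hz; split.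
  + intros H m; destruct (of_nat m) as [n k].
    apply omega_squared_le, Hy, H.
  + intros H n; apply Hy, omega_squared_le; intro k.
    specialize (H (to_nat (n, k))); now rewrite cancel_of_to in H.
Qed.
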